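(* Let $M\ge1$ and $n\ge 1$ be integers. (a) For any word $W=(w_1,\dots,w_n)\in\{0,1\}^n$ of length $n$, with $N_n=N_n(W)$, $$E(N_n^2)=\big(E(N_n)\big)^2\,E\left(\prod_{(r,s):\,J_r=K_s}2\cdot 1(w_r=w_s)\right),$$ where the product is over all pairs $r,s\in\{1,2,\dots,n\}$ with $J_r=K_s$, and $1(A)$ denotes the indicator function of $A$. (b) Let $X$ be the random word of length $n$ comprising independent random letters with the Bernoulli$(\tfrac12)$ distribution, independent of $Y$. Then $$E(N_n(X)^2)=\big(E(N_n(X))\big)^2\,E(2^{Z_n}),$$ where $Z_n$ is the number of visits to zero between times $1$ and $n$ (inclusive) made by the random walk $J-K$, i.e. $Z_n=|\{1\le l\le n: J_l=K_l\}|$.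
   Context: $Y=(Y_1,Y_2,\dots)$ is an i.i.d. sequence of Bernoulli random variables with $P(Y_j=1)=\tfrac12$. For a word $W=(w_1,\dots,w_n)\in\{0,1\}^n$, an $M$-admissible embedding of $W$ in $Y$ is a sequence of integers $(m_1,\dots,m_n)$ such that, with $m_0=0$, $1\le m_i-m_{i-1}\le M$ and $Y_{m_i}=w_i$ for all $1\le i\le n$; $N_n(W)$ is the number of $M$-admissible embeddings of $W$ in $Y$. $J=(J_0,J_1,J_2,\dots)$ and $K=(K_0,K_1,K_2,\dots)$ are independent random walks on $\mathbb Z$ with $J_0=K_0=0$ and i.i.d. steps uniformly distributed on $\{1,2,\dots,M\}$. An empty product equals $1$. *)

(* Defs.v *)
From HB Require Import structures.
From mathcomp Require Import all_boot all_order all_algebra.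
From mathcomp Require Import finmap.
From mathcomp Require Import all_classical all_reals all_analysis.

Set Implicit Arguments.
Unset Strict Implicit.
Unset Printing Implicit Defensive.

Import Order.TTheory GRing.Theory Num.Theory.

Local Open Scope classical_set_scope.
Local Open Scope ring_scope.

(* The library equips nat and bool, but not int, with the discrete
   sigma-algebra. *)
HB.instance Definition _ := isPointed.Build int 0.
HB.instance Definition _ := @isMeasurable.Build default_measure_display
  int discrete_measurable discrete_measurable0
  discrete_measurableC discrete_measurableU.

Section independence.
Context d d' (T : measurableType d) (S : measurableType d') (R : realType).
Variable P : probability T R.

Definition mutually_independent (I : choiceType) (D : set I)
    (X : I -> T -> S) : Prop :=
  forall (F : {fset I}) (A : I -> set S),
    [set` F] `<=` D -> (forall i, measurable (A i)) ->
    P (\bigcap_(i in [set` F]) (X i @^-1` A i)) =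
    (\prod_(i <- F) P (X i @^-1` A i))%E.

Definition sigma_of_family (I : Type) (D : set I) (X : I -> T -> S) :
    set (set T) :=
  <<s \bigcup_(i in D) preimage_set_system setT (X i) measurable >>.

End independence.

Definition independent_systems d (T : measurableType d) (R : realType)
    (P : probability T R) (F G : set (set T)) : Prop :=
  forall A B, F A -> G B -> P (A `&` B) = (P A * P B)%E.

Definition iid_bernoulli d (T : measurableType d) (R : realType)
    (P : probability T R) (p : R) (I : choiceType) (D : set I)
    (X : I -> T -> bool) : Prop :=
  mutually_independent P D X /\
  forall i, D i -> P [set t | X i t = true] = p%:E.

Definition uniform_walk d (T : measurableType d) (R : realType)
    (P : probability T R) (M : nat) (J : nat -> T -> int) : Prop :=
  let step k t := J k.+1 t - J k t in
  [/\ forall t, J 0%N t = 0,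
      mutually_independent P [set: nat] step &
      forall k (l : int), 1 <= l <= M%:Z ->
        P [set t | step k t = l] = (M%:R^-1)%:E].

(* [m] lists m_1, ..., m_n, and [path _ 0 m] compares consecutive entries of
   m_0 = 0, m_1, ..., m_n.  The m_i may be taken in nat because the increments
   are at least 1; the subtraction truncates, but [1 <= b - a] forces [a < b].
   The value [y 0] plays no role. *)
Definition admissible_embeddings (M n : nat) (w : n.-tuple bool)
    (y : nat -> bool) : set (n.-tuple nat) :=
  [set m : n.-tuple nat | path (fun a b => 1 <= b - a <= M)%N 0%N m /\
           forall i : 'I_n, y (tnth m i) = tnth w i].

(* This set is finite (m_i <= i * M), so [fset_set] enumerates it. *)
Definition num_embeddings (M n : nat) (w : n.-tuple bool)
    (y : nat -> bool) : nat :=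
  #|` fset_set (admissible_embeddings M w y)|%fset.

(* Times 1, ..., n correspond to [l.+1] for [l : 'I_n]; likewise the letter w_r
   of a word is [tnth w i] with r = i.+1. *)
Definition visits_to_zero (n : nat) (S : nat -> int) : nat :=
  #|[set l : 'I_n | S l.+1 == 0]%SET|.

(* Main.v *)
(** Admissible embeddings are the paths of walks with steps in {1, ..., M}.
    Hence E(N^2) is the sum over pairs (f, g) of such paths of the probability
    that both spell the word.  If k pairs (r, s) satisfy f_r = g_s, then 2n - k
    letters of Y are prescribed, so this probability is 4^-n times the product
    of 2 * 1(w_r = w_s) over these pairs.  The law of (J, K) is uniform on pairs
    of paths, and E(N) = M^n 2^-n, which gives (a).  For (b), average the product
    over w: its pairs off the diagonal form a forest on the letters of w, because
    f and g are increasing, so each of them contributes a factor 2 * 1/2 = 1,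
    and each pair (l, l) contributes 2. *)
Require Import Defs.
From mathcomp Require Import all_boot all_order all_algebra.
From mathcomp Require Import finmap.
From mathcomp Require Import all_classical all_reals all_analysis.
From mathcomp Require Import zify ring.

Set Implicit Arguments.
Unset Strict Implicit.
Unset Printing Implicit Defensive.

Import Order.TTheory GRing.Theory Num.Theory.

Local Open Scope classical_set_scope.
Local Open Scope ring_scope.

(** * The product over coinciding pairs and its average over words *)

Definition coincidences n (S : eqType) (a b : 'I_n -> S) : {set 'I_n * 'I_n} :=
  [set p | a p.1 == b p.2]%SET.

Section agreement.
Variable R : comNzRingType.

(** The set of pairs is an argument because the product attached to [J] and [K] is random only
    through the set of their meeting pairs. *)
Definition agreement n (w : n.-tuple bool) (G : {set 'I_n * 'I_n}) : R :=
  \prod_(p in G) (2 * (tnth w p.1 == tnth w p.2)%:R).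

Definition increasing n (a : 'I_n -> nat) : Prop :=
  forall i j : 'I_n, (i < j)%N -> (a i < a j)%N.

Lemma increasing_inj n (a : 'I_n -> nat) : increasing a -> injective a.
Proof.
move=> ia i j aij; apply: val_inj.
by case: (ltngtP i j) => // /ia; rewrite aij ltnn.
Qed.

(** The value 1 off the coincidences lets the product run over the full square of indices, which
    splits into rows and columns. *)
Let pair_factor (e x y : bool) : R := if e then 2 * (x == y)%:R else 1.

Lemma agreement_coincidences n (w : n.-tuple bool) (a b : 'I_n -> nat) :
  agreement w (coincidences a b) =
  \prod_(i < n) \prod_(j < n) pair_factor (a i == b j) (tnth w i) (tnth w j).
Proof.
rewrite /agreement pair_big /= big_mkcond /=.
by apply: eq_bigr => p _; rewrite inE.
Qed.

(** By injectivity at most one index [i] has [c i = k]. If there is one, only the letter [x = w_i]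
    contributes, with weight 2; if there is none, both letters contribute 1. *)
Lemma sum_pair_factor n (c : 'I_n -> nat) (w : n.-tuple bool) (k : nat) :
  injective c ->
  \sum_(x : bool) \prod_(i < n) pair_factor (c i == k) x (tnth w i) = 2.
Proof.
move=> cI; have [/existsP [i /eqP cik]|/existsPn ck] := boolP [exists i, c i == k].
  have E x : \prod_(i < n) pair_factor (c i == k) x (tnth w i) =
             2 * (x == tnth w i)%:R.
    rewrite (bigD1 i) //= cik /pair_factor eqxx big1 ?mulr1 // => j ji.
    by rewrite -cik (inj_eq cI) (negbTE ji).
  by rewrite big_bool !E; case: (tnth w i); rewrite /= ?mulr1 ?mulr0 ?addr0 ?add0r.
rewrite (eq_bigr (fun=> 1)) ?big_bool // => x _.
by rewrite big1 // => i _; rewrite /pair_factor (negbTE (ck i)).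
Qed.

(* The first letter is compared with at most one later letter, since a later
   position of one sequence cannot equal the first position of the other while
   an earlier one does; averaging over it costs nothing unless [a 0 = b 0]. *)
Lemma sum_agreement n (a b : 'I_n -> nat) : increasing a -> increasing b ->
  \sum_(w : n.-tuple bool) agreement w (coincidences a b) =
  2 ^+ n * 2 ^+ #|[set l | (l, l) \in coincidences a b]%SET| :> R.
Proof.
(* The product form suits the induction on [n], which splits off the first index. *)
suff H : increasing a -> increasing b ->
  \sum_(w : n.-tuple bool) agreement w (coincidences a b) =
  \prod_(l < n) (2 * (if a l == b l then 2 else 1)) :> R.
  move=> ia ib; rewrite H // big_split /= prodr_const card_ord; congr (_ * _).
  rewrite -big_mkcond prodr_const; congr (_ ^+ _).
  by apply: eq_card => l; rewrite !inE.
elim: n a b => [|n IHn] a b ia ib.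
  rewrite big_ord0 (eq_bigr (fun=> 1)) ?sumr_const ?card_tuple ?expn0 //.
  by move=> w _; rewrite agreement_coincidences big_ord0.
pose a' i := a (lift ord0 i); pose b' i := b (lift ord0 i).
have ia' : increasing a' by move=> i j ij; apply: ia.
have ib' : increasing b' by move=> i j ij; apply: ib.
have a0 i : (a ord0 < a' i)%N by apply: ia.
have b0 i : (b ord0 < b' i)%N by apply: ib.
rewrite (reindex (fun p : bool * n.-tuple bool => [tuple of p.1 :: p.2])) /=; last first.
  exists (fun w => (thead w, [tuple of behead w])) => [[x w] _|w _] /=.
    by congr (_, _); apply: val_inj.
  by rewrite [RHS]tuple_eta.
rewrite -(pair_big xpredT xpredT (fun x (w : n.-tuple bool) =>
  agreement [tuple of x :: w] (coincidences a b))) /= exchange_big /=.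
rewrite big_ord_recl -(IHn a' b') // mulr_sumr; apply: eq_bigr => w _.
(* The square of indices splits into the corner, the rest of the first row, the rest of the first
   column and a smaller square, whose factor does not involve [x]. *)
have step x : agreement [tuple of x :: w] (coincidences a b) =
    pair_factor (a ord0 == b ord0) x x *
    (\prod_(j < n) pair_factor (b' j == a ord0) x (tnth w j)) *
    (\prod_(i < n) pair_factor (a' i == b ord0) x (tnth w i)) *
    agreement w (coincidences a' b').
  rewrite !agreement_coincidences big_ord_recl /= big_ord_recl /= -!mulrA.
  congr (_ * (_ * _)); first by apply: eq_bigr => j _; rewrite tnth0 tnthS eq_sym.
  rewrite -big_split /=; apply: eq_bigr => i _.
  rewrite big_ord_recl /= !tnthS tnth0; congr (_ * _).
    by rewrite /pair_factor (eq_sym x).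
  by apply: eq_bigr => j _; rewrite !tnthS.
under eq_bigr do rewrite step.
rewrite -mulr_suml; congr (_ * _).
have one (c : 'I_n -> nat) k x : (forall i, k < c i)%N ->
    \prod_(i < n) pair_factor (c i == k) x (tnth w i) = 1.
  by move=> kc; rewrite big1 // => i _; rewrite /pair_factor gtn_eqF.
(* If [a 0 < b 0], the row is trivial, since [a 0] lies below every value of [b], and the column
   sums to 2; the opposite case is symmetric. In case of equality row and column are trivial, and
   the corner gives 2 for each of the two letters. *)
case: (ltngtP (a ord0) (b ord0)) => ab.
- rewrite mulr1 -[RHS](sum_pair_factor w (b ord0) (increasing_inj ia')).
  apply: eq_bigr => x _; rewrite one => [|j]; last exact: ltn_trans ab (b0 j).
  by rewrite /pair_factor !mul1r.
- rewrite mulr1 -[RHS](sum_pair_factor w (a ord0) (increasing_inj ib')).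
  apply: eq_bigr => x _; rewrite (one a') => [|j]; last exact: ltn_trans ab (a0 j).
  by rewrite /pair_factor mulr1 mul1r.
- rewrite (eq_bigr (fun=> 2)) => [|x _]; first by rewrite sumr_const card_bool mulr_natl.
  rewrite !one => [|j|j]; [|by rewrite -ab|by rewrite ab].
  by rewrite /pair_factor eqxx !mulr1.
Qed.

End agreement.

(** * Admissible embeddings as paths with steps in {1, ..., M} *)

Section walk.

(** An entry of [s] encodes the step larger by one, so that entries in ['I_M] encode the steps 1,
    ..., M. *)
Definition walk (s : seq nat) (k : nat) : nat := (\sum_(i < k) (nth 0 s i).+1)%N.

Lemma walkS s k : walk s k.+1 = (walk s k + (nth 0 s k).+1)%N.
Proof. by rewrite /walk big_ord_recr. Qed.

Variables M n : nat.

Definition steps (f : n.-tuple 'I_M) : seq nat := map val f.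

Definition walk_tuple (f : n.-tuple 'I_M) : n.-tuple nat :=
  [tuple walk (steps f) i.+1 | i < n].

Lemma increasing_walk_tuple f : increasing (tnth (walk_tuple f)).
Proof.
have mono : {homo walk (steps f) : i j / (i < j)%N}.
  by apply: homo_ltn => [y x z|i]; [exact: ltn_trans|rewrite walkS; lia].
by move=> i j ij; rewrite !tnth_mktuple; apply: mono.
Qed.

(** Each step is the difference of two consecutive positions. *)
Lemma walk_tuple_inj : injective walk_tuple.
Proof.
move=> f g fg.
have W i : (i <= n)%N -> walk (steps f) i = walk (steps g) i.
  case: i => [|i] ilt; first by rewrite /walk !big_ord0.
  by have := congr1 (fun t => tnth t (Ordinal ilt)) fg; rewrite !tnth_mktuple.
apply: eq_from_tnth => i; apply: val_inj => /=.
have := W i.+1 (ltn_ord i); rewrite !walkS W; last exact: ltnW.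
move=> /addnI [].
by rewrite /steps !(nth_map (tnth f i)) ?size_tuple // -!tnth_nth.
Qed.

Lemma path_walk_tuple (f : n.-tuple 'I_M) :
  path (fun a b => 1 <= b - a <= M)%N 0%N (walk_tuple f).
Proof.
apply/(pathP 0%N) => i; rewrite size_tuple => ilt.
have -> : nth 0%N (0%N :: walk_tuple f) i = walk (steps f) i.
  case: i ilt => [|i] ilt /=; first by rewrite /walk big_ord0.
  by rewrite -[i]/(nat_of_ord (Ordinal (ltnW ilt))) nth_mktuple.
rewrite -[i in nth _ _ i]/(nat_of_ord (Ordinal ilt)) nth_mktuple /= walkS.
rewrite addKn /= /steps (nth_map (tnth f (Ordinal ilt))) ?size_tuple //.
exact: ltn_ord.
Qed.

Lemma walk_tupleP (m : n.-tuple nat) :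
  path (fun a b => 1 <= b - a <= M)%N 0%N m -> exists f, m = walk_tuple f.
Proof.
move=> /(pathP 0%N); rewrite size_tuple => mP.
(* The increment is lowered by one to match the encoding of steps; the prepended 0 is m_0. *)
pose inc i := ((nth 0 m i - nth 0 (0 :: m) i).-1)%N.
have incP i : (i < n)%N -> (inc i < M)%N.
  by move=> /mP; rewrite /inc; lia.
pose f := [tuple Ordinal (incP i (ltn_ord i)) | i < n].
exists f.
have W k : (k <= n)%N -> nth 0%N (0%N :: m) k = walk (steps f) k.
  elim: k => [|k IHk] kn; first by rewrite /walk big_ord0.
  rewrite walkS -IHk ?(ltnW kn) // /steps.
  rewrite (nth_map (tnth f (Ordinal kn))) ?size_tuple //.
  rewrite -[k in nth (tnth _ _) _ k]/(nat_of_ord (Ordinal kn)) nth_mktuple /=.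
  by have := mP _ kn; rewrite /inc /=; lia.
apply: eq_from_tnth => i; rewrite tnth_mktuple -W //=.
by rewrite (tnth_nth 0%N).
Qed.

(** Step sequences parametrize bijectively the sequences with admissible increments, so only the
    condition on the letters remains to be tested. *)
Lemma num_embeddingsE (w : n.-tuple bool) (y : nat -> bool) :
  num_embeddings M w y =
  (\sum_(f : n.-tuple 'I_M) [forall i, y (tnth (walk_tuple f) i) == tnth w i])%N.
Proof.
rewrite /num_embeddings.
set good := [set f : n.-tuple 'I_M |
  [forall i, y (tnth (walk_tuple f) i) == tnth w i]]%SET.
have -> : admissible_embeddings M w y = walk_tuple @` [set` good].
  apply/seteqP; split => [m [/walk_tupleP [f ->] mw]|_ [f /= + <-]].
    by exists f => //=; rewrite inE; apply/forallP => i; rewrite mw.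
  rewrite inE => /forallP fw; split; first exact: path_walk_tuple.
  by move=> i; apply/eqP.
rewrite fset_set_image; last exact: finite_finset.
rewrite card_imfset /=; last exact: walk_tuple_inj.
transitivity #|good|; last by rewrite -sum1_card big_mkcond;
  apply: eq_bigr => f _; rewrite inE; case: ifP.
rewrite cardE; apply: perm_size; apply: uniq_perm; rewrite ?fset_uniq ?enum_uniq //.
move=> f; rewrite mem_enum in_fset_set; last exact: finite_finset.
by apply/idP/idP; rewrite inE.
Qed.

End walk.

(** * Expectations of random variables with finitely many values *)

Section simple_expectation.
Context d (T : measurableType d) (R : realType) (P : probability T R).

Lemma expectation_sum_indic (I : finType) (c : I -> R) (A : I -> set T) :
  (forall i, measurable (A i)) ->
  ('E_P[fun t => (\sum_i c i * \1_(A i) t)%R])%E =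
  (\sum_i c i * fine (P (A i)))%:E.
Proof.
move=> mA; rewrite unlock; under eq_integral do rewrite -sumEFin.
rewrite integral_sum // => [|i]; last first.
  by under eq_fun do rewrite EFinM; apply: integrableZl => //; apply: integrable_indic.
rewrite -sumEFin; apply: eq_bigr => i _; under eq_integral do rewrite EFinM.
rewrite integralZl //; last exact: integrable_indic.
by rewrite integral_indic // setIT EFinM fineK // fin_num_measure.
Qed.

(** Decompose [h (V t)] along the fibres of [V]. Measurability is asked of the fibres, as [I]
    carries no sigma-algebra. *)
Lemma expectation_finite (I : finType) (V : T -> I) (h : I -> R) :
  (forall i, measurable (V @^-1` [set i])) ->
  ('E_P[fun t => h (V t)])%E = (\sum_i h i * fine (P (V @^-1` [set i])))%:E.
Proof.
move=> mV; rewrite -expectation_sum_indic //; congr expectation.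
apply/funext => t; rewrite (bigD1 (V t)) //= big1 => [|i iV].
  by rewrite indicE mem_set // mulr1 addr0.
by rewrite indicE memNset ?mulr0 //= => /esym/eqP; rewrite (negbTE iV).
Qed.

(* If the [E i] exhaust the mass, [B] is decomposed along them even though they
   need not cover [T]. *)
Lemma measure_total (I : finType) (E : I -> set T) (B : set T) :
  (forall i, measurable (E i)) -> measurable B ->
  (forall i j t, E i t -> E j t -> i = j) ->
  \sum_i fine (P (E i)) = 1 ->
  fine (P B) = \sum_i fine (P (B `&` E i)).
Proof.
move=> mE mB disjE E1.
(* Finite additivity, read off from the expectation of the indicator of a disjoint union. *)
have additive (F : I -> set T) : (forall i, measurable (F i)) ->
    (forall i j t, F i t -> F j t -> i = j) ->
    P (\bigcup_(i in [set: I]) F i) = (\sum_i fine (P (F i)))%:E.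
  move=> mF disjF; have mU : measurable (\bigcup_(i in [set: I]) F i).
    exact: fin_bigcup_measurable.
  under eq_bigr do rewrite -[fine _]mul1r.
  rewrite -(expectation_indic P mU) -expectation_sum_indic //; congr expectation.
  apply/funext => t; have [[i _ Fi]|nF] := pselect ((\bigcup_(i in [set: I]) F i) t).
    rewrite indicE mem_set; last by exists i.
    rewrite (bigD1 i) //= big1 => [|j ji]; first by rewrite indicE mem_set // mulr1 addr0.
    rewrite indicE memNset ?mulr0 //= => Fj.
    by rewrite (disjF _ _ _ Fi Fj) eqxx in ji.
  rewrite indicE memNset // big1 // => i _; rewrite indicE memNset ?mulr0 //= => Fi.
  by apply: nF; exists i.
pose U := \bigcup_(i in [set: I]) E i.
have mU : measurable U by apply: fin_bigcup_measurable.
(* The complement of [U] is null, so [B] loses no mass when intersected with [U]. *)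
have PU : P (~` U) = 0%E by rewrite probability_setC // additive // E1 subee.
rewrite -[RHS]/(fine (\sum_i fine (P (B `&` E i)))%:E) -additive.
- rewrite -setI_bigcupr -/U (measureDI P mB mU) setDE.
  by rewrite (subset_measure0 (B := ~` U)) ?add0e //; do ?apply: measurableI => //;
    exact: measurableC.
- by move=> i; apply: measurableI.
- by move=> i j t [_ Ei] [_ Ej]; apply: disjE Ei Ej.
Qed.

End simple_expectation.

(** * Events prescribing finitely many values of a family *)

Section values_at.
Context d (T : measurableType d) (R : realType) (P : probability T R).
Context d' (S : measurableType d').
Hypothesis measurable_singleton : forall x : S, measurable [set x].
Variable I : choiceType.

(** Common form of three events: [Y] spells a word along an embedding, [X] equals a word, a walk
    follows a path. *)
Definition values_at n (X : I -> T -> S) (a : 'I_n -> I) (w : 'I_n -> S) : set T :=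
  [set t | forall i, X (a i) t = w i].

Lemma values_at_bigcap n (X : I -> T -> S) (a : 'I_n -> I) (w : 'I_n -> S) :
  values_at X a w = \bigcap_(i in [set: 'I_n]) (X (a i) @^-1` [set w i]).
Proof. by apply/seteqP; split=> [t tw i _|t tw i]; apply: tw. Qed.

Variables (n : nat) (X : I -> {RV P >-> S}) (a : 'I_n -> I) (w : 'I_n -> S).

Lemma values_at_sigma (D : set I) : (forall i, D (a i)) ->
  sigma_of_family D X (values_at X a w).
Proof.
move=> Da; rewrite values_at_bigcap.
apply: (@fin_bigcap_measurable _ (g_sigma_algebraType
  (\bigcup_(i in D) preimage_set_system setT (X i) measurable))) => // i _.
apply: sub_sigma_algebra; exists (a i); first exact: Da.
by exists [set w i]; rewrite ?setTI.
Qed.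

Lemma measurable_values_at : measurable (values_at X a w).
Proof.
rewrite values_at_bigcap.
by apply: fin_bigcap_measurable => // i _; apply: measurable_funPTI.
Qed.

End values_at.

(** * Probability that fair letters spell one or two prescribed words *)

Section bernoulli_words.
Context d (T : measurableType d) (R : realType) (P : probability T R).
Variables (I : choiceType) (D : set I) (X : I -> {RV P >-> bool}).
Hypothesis iid : iid_bernoulli P 2^-1 D X.

(** Both values of a letter have probability 1/2, so only the number of prescribed letters
    matters. *)
Lemma iid_bernoulli_half_cylinder (F : {fset I}) (v : I -> bool) :
  [set` F] `<=` D ->
  P (\bigcap_(i in [set` F]) (X i @^-1` [set v i])) = (2^-1 ^+ #|` F|)%:E.
Proof.
move=> FD; have [ind ber] := iid; rewrite ind //.
have half i b : D i -> P (X i @^-1` [set b]) = (2^-1)%:E.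
  move=> Di; have Pt : P (X i @^-1` [set true]) = (2^-1)%:E by exact: ber.
  case: b => //; rewrite (_ : _ @^-1` _ = ~` (X i @^-1` [set true])).
    rewrite probability_setC; last exact: measurable_funPTI.
    by rewrite Pt -EFinB; congr EFin; rewrite {1}(splitr 1) mul1r addrK.
  by apply/seteqP; split=> t /=; case: (X i t).
rewrite (eq_big_seq (fun=> (2^-1)%:E)) => [|i iF]; last exact/half/FD.
by rewrite prodEFin big_const_seq count_predT iter_mulr_1.
Qed.

Lemma prob_word n (w : n.-tuple bool) (a : 'I_n -> I) :
  (forall i, D (a i)) -> injective a ->
  P (values_at X a (tnth w)) = (2^-1 ^+ n)%:E.
Proof.
move=> Da aI.
(* The prescription transported from indices to positions, with default [false] outside the image of
   [a]. *)
pose v x := [exists i, (a i == x) && tnth w i].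
have va i : v (a i) = tnth w i.
  apply/existsP/idP => [[k /andP[/eqP/aI ->]] //|wi].
  by exists i; rewrite eqxx.
have Fn : #|` [fset a i | i in 'I_n]%fset| = n.
  by rewrite card_imfset //= -cardE card_ord.
have -> : 2^-1 ^+ n = 2^-1 ^+ #|` [fset a i | i in 'I_n]%fset| :> R by rewrite Fn.
rewrite -(iid_bernoulli_half_cylinder v) => [|x /imfsetP[i _ ->] //].
congr (P _); apply/seteqP; split=> t /= tw.
  by move=> x /= /imfsetP[i _ ->]; rewrite va; apply: tw.
by move=> i; rewrite -va; apply: tw; apply/imfsetP; exists i.
Qed.

(* The two embeddings prescribe [2 n - #|coincidences a b|] letters of [X], and
   a prescription is contradictory exactly when some factor of [agreement] is
   zero. *)
Lemma prob_two_words n (w : n.-tuple bool) (a b : 'I_n -> I) :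
  (forall i, D (a i)) -> (forall i, D (b i)) -> injective a -> injective b ->
  P (values_at X a (tnth w) `&` values_at X b (tnth w)) =
  (2^-1 ^+ n * 2^-1 ^+ n * agreement R w (coincidences a b))%:E.
Proof.
move=> Da Db aI bI.
have [cons|] := boolP [forall p in coincidences a b, tnth w p.1 == tnth w p.2]; last first.
  (* One position would have to carry two different letters, so the event is empty. *)
  move=> /forall_inPn[p pab wp]; rewrite /agreement (bigD1 p) //= (negbTE wp).
  rewrite mulr0 mul0r mulr0 (_ : _ `&` _ = set0) ?measure0 //.
  apply/seteqP; split=> // t [ta tb]; move: wp pab; rewrite !inE.
  by rewrite -ta -tb => /eqP + /eqP abp; rewrite abp.
rewrite /agreement (eq_bigr (fun=> 2)) => [|p pab]; last first.
  by rewrite (forall_inP cons) ?mulr1.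
rewrite prodr_const.
(* The two prescriptions merge into one, consistently by [cons]. *)
pose v x := [exists i, ((a i == x) || (b i == x)) && tnth w i].
have wab i j : a i = b j -> tnth w i = tnth w j.
  by move=> ab; apply/eqP/(forall_inP cons (i, j)); rewrite inE /= ab.
have va i : v (a i) = tnth w i.
  apply/existsP/idP => [[k /andP[/orP[/eqP/aI ->//|/eqP ba]]]|wi].
    by rewrite (wab _ _ (esym ba)).
  by exists i; rewrite eqxx.
have vb i : v (b i) = tnth w i.
  apply/existsP/idP => [[k /andP[/orP[/eqP ab|/eqP/bI -> //]]]|wi].
    by rewrite (wab _ _ ab).
  by exists i; rewrite eqxx orbT.
pose FA := [fset a i | i in 'I_n]%fset; pose FB := [fset b i | i in 'I_n]%fset.
have FAn : #|` FA| = n by rewrite card_imfset //= -cardE card_ord.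
have FBn : #|` FB| = n by rewrite card_imfset //= -cardE card_ord.
(* Injectivity of [a] and [b] matches each common position with exactly one coinciding pair. *)
have FI : #|` (FA `&` FB)%fset| = #|coincidences a b|.
  have -> : (FA `&` FB)%fset = [fset a p.1 | p in coincidences a b]%fset.
    apply/fsetP => x; apply/fsetIP/imfsetP => [[/imfsetP[i _ ->] /imfsetP[j _ ab]]|].
      by exists (i, j) => //=; rewrite inE ab.
    move=> [[i j] /=]; rewrite inE /= => /eqP ab ->.
    by split; apply/imfsetP; [exists i|exists j].
  rewrite card_in_imfset /= ?cardE // => [[i j] [i' j']] /=.
  rewrite !inE /= => /eqP ij /eqP ij' /aI ii; rewrite ii in ij *.
  by congr (_, _); apply: bI; rewrite -ij -ij'.
rewrite (_ : _ `&` _ = \bigcap_(x in [set` (FA `|` FB)%fset]) (X x @^-1` [set v x])).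
  rewrite iid_bernoulli_half_cylinder => [|x /fsetUP[]/imfsetP[i _ ->] //].
  have nn : (n + n = #|` (FA `|` FB)%fset| + #|coincidences a b|)%N.
    by rewrite -FI cardfsUI FAn FBn.
  congr EFin; rewrite -exprD nn exprD.
  by rewrite -mulrA -exprMn mulVf ?expr1n ?mulr1 // pnatr_eq0.
apply/seteqP; split=> [t [ta tb] x /=|t tab].
  by case/fsetUP => /imfsetP[i _ ->]; rewrite ?va ?vb.
split=> i; [rewrite -va|rewrite -vb]; apply: tab; apply/fsetUP; [left|right];
  by apply/imfsetP; exists i.
Qed.

End bernoulli_words.

(** * The law of the meeting pairs of two independent uniform walks *)

Section uniform_walks.
Context d (T : measurableType d) (R : realType) (Q : probability T R).
Variables (M n : nat).
Hypothesis M_gt0 : (0 < M)%N.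

Definition follows (J : nat -> T -> int) (f : n.-tuple 'I_M) : set T :=
  values_at J (fun i : 'I_n => i.+1) (fun i => (tnth (walk_tuple f) i)%:Z).

(** Since the walk starts at 0, positions and steps determine each other; the steps have a known
    joint law. *)
Lemma followsP (J : nat -> T -> int) (f : n.-tuple 'I_M) t : J 0%N t = 0 ->
  follows J f t <->
  forall k, (k < n)%N -> J k.+1 t - J k t = ((nth 0 (steps f) k).+1)%:Z.
Proof.
move=> J0.
have walk0 : walk (steps f) 0 = 0%N by rewrite /walk big_ord0.
split=> [Jf k kn|Jf i].
  have W j : (j <= n)%N -> J j t = walk (steps f) j.
    case: j => [|j] jn; first by rewrite J0 walk0.
    by have := Jf (Ordinal jn); rewrite tnth_mktuple.
  by rewrite !W ?(ltnW kn) // walkS PoszD addrC addKr.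
have W j : (j <= n)%N -> J j t = walk (steps f) j.
  elim: j => [|j IHj] jn; first by rewrite J0 walk0.
  by rewrite walkS PoszD -(Jf _ jn) IHj ?(ltnW jn) // addrC subrK.
by rewrite tnth_mktuple; apply: W.
Qed.

Lemma prob_follows (J : nat -> {RV Q >-> int}) (f : n.-tuple 'I_M) :
  uniform_walk Q M J -> Q (follows J f) = (M%:R^-1 ^+ n)%:E.
Proof.
move=> [J0 ind unif]; pose F := [fset k in iota 0 n]%fset.
have FE k : (k \in F) = (k < n)%N by rewrite !inE mem_iota.
have Fn : #|` F| = n.
  by rewrite card_fseq undup_id ?iota_uniq // size_iota.
have -> : follows J f = \bigcap_(k in [set` F])
    ((fun t => J k.+1 t - J k t) @^-1` [set ((nth 0 (steps f) k).+1)%:Z]).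
  apply/seteqP; split=> t; first by move=> /followsP /= Jf k /=; rewrite FE; apply: Jf.
  by move=> tF; apply/followsP => // k kn; apply: tF; rewrite /= FE.
rewrite ind // (eq_big_seq (fun=> (M%:R^-1)%:E)) => [|k]; last first.
  rewrite FE => kn; apply: unif; rewrite /= lez_nat.
  by rewrite /steps (nth_map (tnth f (Ordinal kn))) ?size_tuple // ltn_ord.
by rewrite prodEFin big_const_seq count_predT iter_mulr_1 Fn.
Qed.

Variables J K : nat -> {RV Q >-> int}.
Hypotheses (hJ : uniform_walk Q M J) (hK : uniform_walk Q M K).
Hypothesis hJK : independent_systems Q (sigma_of_family [set: nat] J)
  (sigma_of_family [set: nat] K).

(** Both random variables averaged over the walks in the theorem are functions of this finite-valued
    random set. *)
Let meeting t : {set 'I_n * 'I_n} :=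
  coincidences (fun i : 'I_n => J i.+1 t) (fun i : 'I_n => K i.+1 t).

Let measurable_meeting G : measurable (meeting @^-1` [set G]).
Proof.
(* The event splits over the countably many common values. *)
have meq i j : measurable [set t | J i t == K j t].
  rewrite (_ : mkset _ = \bigcup_(z : int) (J i @^-1` [set z] `&` K j @^-1` [set z])).
    by apply: countable_bigcupT_measurable => // z; apply: measurableI; apply: measurable_funPTI.
  by apply/seteqP; split=> [t /= /eqP E|t [z _ [/= -> ->]] //]; exists (K j t).
rewrite (_ : _ @^-1` _ = \bigcap_(p in [set: 'I_n * 'I_n])
    [set t | (J p.1.+1 t == K p.2.+1 t) = (p \in G)]).
  apply: fin_bigcap_measurable => // p _.
  case: (p \in G); first exact: meq.
  rewrite (_ : mkset _ = ~` [set t | J p.1.+1 t == K p.2.+1 t]); first exact: measurableC.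
  by apply/seteqP; split=> t /=; [move=> ->|move/negP/negbTE].
apply/seteqP; split=> [t /= <- p _|t tG]; first by rewrite /= inE.
by apply/setP => p; rewrite inE tG.
Qed.

(** The pair of paths is uniform, by independence, and determines the meeting set. A general [h]
    serves both parts of the theorem. *)
Lemma expectation_meeting (h : {set 'I_n * 'I_n} -> R) :
  ('E_Q[fun t => h (coincidences (fun i : 'I_n => J i.+1 t)
                                 (fun i : 'I_n => K i.+1 t))])%E =
  (\sum_(p : n.-tuple 'I_M * n.-tuple 'I_M)
     M%:R^-1 ^+ n * M%:R^-1 ^+ n *
     h (coincidences (tnth (walk_tuple p.1)) (tnth (walk_tuple p.2))))%:E.
Proof.
pose E (p : n.-tuple 'I_M * n.-tuple 'I_M) := follows J p.1 `&` follows K p.2.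
have m1 (z : int) : measurable [set z] by [].
have mE p : measurable (E p) by apply: measurableI; apply: measurable_values_at.
have QE p : Q (E p) = (M%:R^-1 ^+ n * M%:R^-1 ^+ n)%:E.
  by rewrite /E hJK ?prob_follows //; apply: values_at_sigma.
have follows_inj (L : nat -> T -> int) f g t : follows L f t -> follows L g t -> f = g.
  move=> Lf Lg; apply: walk_tuple_inj; apply: eq_from_tnth => i.
  by apply/eqP; rewrite -eqz_nat -Lf -Lg.
have disjE p q t : E p t -> E q t -> p = q.
  case: p q => [f g] [f' g'] [/= Jf Kg] [/= Jf' Kg'].
  by congr (_, _); [apply: follows_inj Jf Jf'|apply: follows_inj Kg Kg'].
(* There are M^(2n) pairs of paths, each of probability M^(-2n); hence paths with a step outside {1,
   ..., M} form a null event. *)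
have E1 : \sum_p fine (Q (E p)) = 1.
  under eq_bigr do rewrite QE /=.
  rewrite sumr_const card_prod card_tuple card_ord -[LHS]mulr_natr natrM natrX.
  rewrite mulrACA -exprMn mulVf ?expr1n ?mulr1 //.
  by rewrite pnatr_eq0 -lt0n.
have meetE p t : E p t ->
    meeting t = coincidences (tnth (walk_tuple p.1)) (tnth (walk_tuple p.2)).
  by move=> [Jp Kp]; apply/setP => r; rewrite !inE Jp Kp eqz_nat.
rewrite (expectation_finite Q h measurable_meeting); congr EFin.
under eq_bigr do rewrite (measure_total mE (measurable_meeting _) disjE E1) mulr_sumr.
rewrite exchange_big /=; apply: eq_bigr => p _.
(* On [E p] the meeting set is constant, so a single term of the sum over [G] survives. *)
set G0 := coincidences _ _.
rewrite (bigD1 G0) //= big1 ?addr0 => [|G GG0].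
  rewrite (_ : _ `&` _ = E p) ?QE /= 1?mulrC //.
  by apply/seteqP; split=> [t []|t Ep] //; split=> //; apply: meetE.
rewrite (_ : _ `&` _ = set0) ?measure0 ?mulr0 //.
by apply/seteqP; split=> // t [/= tG /meetE E2]; rewrite -tG E2 eqxx in GG0.
Qed.

End uniform_walks.

(** * First two moments of the number of embeddings of a fixed word *)

Section embeddings.
Context d (T : measurableType d) (R : realType) (P : probability T R).
Variables (M n : nat) (Y : nat -> {RV P >-> bool}).
Hypothesis hY : iid_bernoulli P 2^-1 [set j : nat | (1 <= j)%N] Y.

Definition spells (w : n.-tuple bool) (f : n.-tuple 'I_M) : set T :=
  values_at Y (tnth (walk_tuple f)) (tnth w).

Lemma measurable_spells w f : measurable (spells w f).
Proof. exact: measurable_values_at. Qed.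

Lemma walk_tuple_ge1 (f : n.-tuple 'I_M) i : (1 <= tnth (walk_tuple f) i)%N.
Proof. by rewrite tnth_mktuple walkS addnS. Qed.

Lemma num_embeddings_indic (w : n.-tuple bool) t :
  (num_embeddings M w (fun j => Y j t))%:R = \sum_f \1_(spells w f) t :> R.
Proof.
rewrite num_embeddingsE natr_sum; apply: eq_bigr => f _; rewrite indicE.
congr (_%:R); congr nat_of_bool; apply/forallP/idP => [tf|].
  by rewrite mem_set // => i; apply/eqP.
by rewrite inE => tf i; apply/eqP.
Qed.

Lemma num_embeddings_sqr_indic (w : n.-tuple bool) t :
  (num_embeddings M w (fun j => Y j t))%:R ^+ 2 =
  \sum_p \1_(spells w p.1 `&` spells w p.2) t :> R.
Proof.
rewrite num_embeddings_indic expr2 big_distrlr pair_big /=.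
by apply: eq_bigr => p _; rewrite indicI.
Qed.

Lemma prob_spells w f : P (spells w f) = (2^-1 ^+ n)%:E.
Proof.
apply: (prob_word hY) => [i|]; first exact: walk_tuple_ge1.
exact/increasing_inj/increasing_walk_tuple.
Qed.

Lemma prob_spells2 w f g : P (spells w f `&` spells w g) =
  (2^-1 ^+ n * 2^-1 ^+ n *
   agreement R w (coincidences (tnth (walk_tuple f)) (tnth (walk_tuple g))))%:E.
Proof.
apply: (prob_two_words hY) => [i|i||]; try exact: walk_tuple_ge1;
  exact/increasing_inj/increasing_walk_tuple.
Qed.

Lemma expectation_num_embeddings (w : n.-tuple bool) :
  ('E_P[fun t => (num_embeddings M w (fun j => Y j t))%:R])%E =
  ((M ^ n)%:R * 2^-1 ^+ n)%:E.
Proof.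
under eq_fun => t do rewrite num_embeddings_indic -(eq_bigr _ (fun f _ => mul1r _)).
rewrite expectation_sum_indic => [|f]; last exact: measurable_spells.
under eq_bigr do rewrite prob_spells mul1r.
by rewrite sumr_const card_tuple card_ord mulr_natl.
Qed.

Lemma expectation_num_embeddings_sqr (w : n.-tuple bool) :
  ('E_P[fun t => ((num_embeddings M w (fun j => Y j t))%:R ^+ 2)%R])%E =
  (\sum_(p : n.-tuple 'I_M * n.-tuple 'I_M) 2^-1 ^+ n * 2^-1 ^+ n *
     agreement R w (coincidences (tnth (walk_tuple p.1)) (tnth (walk_tuple p.2))))%:E.
Proof.
under eq_fun => t do rewrite num_embeddings_sqr_indic -(eq_bigr _ (fun f _ => mul1r _)).
rewrite expectation_sum_indic => [|p]; last by apply: measurableI; apply: measurable_spells.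
by under eq_bigr do rewrite prob_spells2 mul1r.
Qed.

(** * First two moments for a random word *)

Variable X : 'I_n -> {RV P >-> bool}.
Hypothesis hX : iid_bernoulli P 2^-1 [set: 'I_n] X.
Hypothesis hXY : independent_systems P (sigma_of_family [set: 'I_n] X)
  (sigma_of_family [set j : nat | (1 <= j)%N] Y).

Let word t := [tuple X i t | i < n].
Let reads w : set T := values_at X id (tnth w).

Let measurable_reads w : measurable (reads w).
Proof. exact: measurable_values_at. Qed.

Let prob_reads w : P (reads w) = (2^-1 ^+ n)%:E.
Proof. by apply: (prob_word hX). Qed.

Let prob_readsI w B : measurable B ->
  sigma_of_family [set j : nat | (1 <= j)%N] Y B ->
  P (reads w `&` B) = (2^-1 ^+ n * fine (P B))%:E.
Proof.
move=> mB sB; rewrite hXY ?prob_reads //; last exact: values_at_sigma.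
by rewrite EFinM fineK // fin_num_measure.
Qed.

(** Exactly one event [reads w] occurs at [t], the one with [w = word t]. This turns a sum indexed
    through the random word into a sum of indicators attached to fixed words. *)
Let sum_word (I : finType) (A : n.-tuple bool -> I -> set T) t :
  \sum_i \1_(A (word t) i) t =
  \sum_(q : n.-tuple bool * I) 1 * \1_(reads q.1 `&` A q.1 q.2) t :> R.
Proof.
rewrite -(pair_big xpredT xpredT (fun w i => 1 * \1_(reads w `&` A w i) t)) /=.
rewrite (bigD1 (word t)) //= [X in _ + X]big1 ?addr0 => [|w ww].
  apply: eq_bigr => i _; rewrite mul1r indicI /= [\1_(reads _) _]indicE mem_set ?mul1r //.
  by move=> j; rewrite tnth_mktuple.
apply: big1 => i _; rewrite indicI /= [\1_(reads _) _]indicE memNset ?mul0r ?mulr0 //.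
move=> tw; case/eqP: ww; apply: eq_from_tnth => j.
by rewrite tnth_mktuple tw.
Qed.

Let spells_sigma w f : sigma_of_family [set j : nat | (1 <= j)%N] Y (spells w f).
Proof. by apply: values_at_sigma => // i; apply: walk_tuple_ge1. Qed.

Let spells2_sigma w f g :
  sigma_of_family [set j : nat | (1 <= j)%N] Y (spells w f `&` spells w g).
Proof.
by apply: (@measurableI _ (g_sigma_algebraType (\bigcup_(i in [set j : nat | (1 <= j)%N])
  preimage_set_system setT (Y i) measurable))); apply: spells_sigma.
Qed.

Let measurable_spells2 w f g : measurable (spells w f `&` spells w g).
Proof. by apply: measurableI; apply: measurable_spells. Qed.

Lemma expectation_num_embeddings_random :
  ('E_P[fun t => (num_embeddings M [tuple X i t | i < n] (fun j => Y j t))%:R])%E =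
  ((M ^ n)%:R * 2^-1 ^+ n)%:E.
Proof.
under eq_fun => t do rewrite num_embeddings_indic (sum_word spells).
rewrite expectation_sum_indic => [|q]; last first.
  by apply: measurableI => //; apply: measurable_spells.
under eq_bigr do rewrite mul1r (prob_readsI _ (measurable_spells _ _)) // prob_spells /=.
rewrite sumr_const card_prod !card_tuple card_ord card_bool; congr EFin.
rewrite -[LHS]mulr_natl natrM.
by rewrite mulrACA [(2 ^ n)%:R]natrX -exprMn divff ?expr1n ?mul1r // pnatr_eq0.
Qed.

Lemma expectation_num_embeddings_random_sqr :
  ('E_P[fun t => ((num_embeddings M [tuple X i t | i < n] (fun j => Y j t))%:R ^+ 2)%R])%E =
  (\sum_(p : n.-tuple 'I_M * n.-tuple 'I_M) 2^-1 ^+ n * 2^-1 ^+ n *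
     2 ^+ #|[set l | (l, l) \in
       coincidences (tnth (walk_tuple p.1)) (tnth (walk_tuple p.2))]%SET|)%:E.
Proof.
under eq_fun => t do rewrite num_embeddings_sqr_indic
  (sum_word (fun w p => spells w p.1 `&` spells w p.2)).
rewrite expectation_sum_indic => [|q]; last first.
  by apply: measurableI => //; apply: measurableI; apply: measurable_spells.
under eq_bigr do rewrite mul1r (prob_readsI _ (measurable_spells2 _ _ _)) // prob_spells2 /=.
rewrite -(pair_big xpredT xpredT (fun w (p : n.-tuple 'I_M * n.-tuple 'I_M) =>
  2^-1 ^+ n * (2^-1 ^+ n * 2^-1 ^+ n * agreement R w
    (coincidences (tnth (walk_tuple p.1)) (tnth (walk_tuple p.2)))))) /=.
(* For a fixed pair of paths the inner sum now runs over words, as in [sum_agreement]; its factor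
   2^n cancels the probability 2^(-n) of each word. *)
rewrite exchange_big /=; congr EFin; apply: eq_bigr => p _.
rewrite -!mulr_sumr sum_agreement; try exact: increasing_walk_tuple.
rewrite mulrCA; congr (_ * _).
by rewrite mulrA -exprMn mulVf ?expr1n ?mul1r // pnatr_eq0.
Qed.

End embeddings.

(** * Comparison of second moments with averages over the walks *)

Lemma rescale_sum (R : realType) (M n : nat) (I : finType) (h : I -> R) : (0 < M)%N ->
  \sum_i 2^-1 ^+ n * 2^-1 ^+ n * h i =
  ((M ^ n)%:R * 2^-1 ^+ n) ^+ 2 * \sum_i M%:R^-1 ^+ n * M%:R^-1 ^+ n * h i.
Proof.
move=> M0; rewrite mulr_sumr; apply: eq_bigr => i _.
(* Thus the weight 4^(-n) is the squared mean (M^n 2^(-n))^2 times M^(-2n), the probability of a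
   pair of paths. *)
have M1 : (M ^ n)%:R * M%:R^-1 ^+ n = 1 :> R.
  by rewrite natrX -exprMn divff ?expr1n // pnatr_eq0 -lt0n.
rewrite mulrA; congr (_ * _); rewrite -[LHS]mul1r -{1}[1](mulr1 1) -{1 2}M1; ring.
Qed.

Theorem theorem4 (R : realType) (M n : nat) (hM : (1 <= M)%N) (hn : (1 <= n)%N)
    (d : measure_display) (T : measurableType d) (P : probability T R)
    (Y : nat -> {RV P >-> bool})
    (hY : iid_bernoulli P (2^-1) [set j : nat | (1 <= j)%N] Y)
    (d' : measure_display) (T' : measurableType d') (Q : probability T' R)
    (J K : nat -> {RV Q >-> int})
    (hJ : uniform_walk Q M J) (hK : uniform_walk Q M K)
    (hJK : independent_systems Q (sigma_of_family [set: nat] J)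
                                 (sigma_of_family [set: nat] K)) :
  (forall w : n.-tuple bool,
     let N (t : T) : R := (num_embeddings M w (fun j => Y j t))%:R in
     ('E_P[fun t => (N t ^+ 2)%R])%E =
     ('E_P[N] ^+ 2 *
      'E_Q[fun t => (\prod_(p : 'I_n * 'I_n | J p.1.+1 t == K p.2.+1 t)
                       (2 * (tnth w p.1 == tnth w p.2)%:R))%R])%E)
  /\
  (forall X : 'I_n -> {RV P >-> bool},
     iid_bernoulli P (2^-1) [set: 'I_n] X ->
     independent_systems P (sigma_of_family [set: 'I_n] X)
       (sigma_of_family [set j : nat | (1 <= j)%N] Y) ->
     let N (t : T) : R :=
       (num_embeddings M [tuple X i t | i < n] (fun j => Y j t))%:R in
     ('E_P[fun t => (N t ^+ 2)%R])%E =
     ('E_P[N] ^+ 2 *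
      'E_Q[fun t => (2 ^+ visits_to_zero n (fun l => J l t - K l t))%R])%E).
Proof.
(* In each part the variable averaged under [Q] is first rewritten as a function of the meeting
   pairs. *)
split=> [w|X hX hXY] /=.
  rewrite expectation_num_embeddings_sqr // expectation_num_embeddings //.
  rewrite [X in (_ * 'E_Q[X])%E](_ : _ = fun t => agreement R w
      (coincidences (fun i : 'I_n => J i.+1 t) (fun i : 'I_n => K i.+1 t))).
    by rewrite (expectation_meeting hM hJ hK hJK (agreement R w)) -!EFinM (rescale_sum _ _ hM) expr2.
  by apply/funext => t; apply: eq_bigl => p; rewrite inE.
rewrite expectation_num_embeddings_random_sqr // expectation_num_embeddings_random //.
rewrite [X in (_ * 'E_Q[X])%E](_ : _ = fun t => 2 ^+ #|[set l | (l, l) \in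
    coincidences (fun i : 'I_n => J i.+1 t) (fun i : 'I_n => K i.+1 t)]%SET|).
  by rewrite (expectation_meeting hM hJ hK hJK
    (fun G => 2 ^+ #|[set l | (l, l) \in G]%SET|)) -!EFinM (rescale_sum _ _ hM) expr2.
apply/funext => t; congr (_ ^+ _); apply: eq_card => l.
by rewrite !inE subr_eq0.
Qed.
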